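(* Let $\bar S = \{(x,y) \in cl(conv(S^L)) : x \le u\}$. Then $conv(S^U) = \bar S$.
   Context: Let $n\ge 1$, $N=\{1,\dots,n\}$, $r>0$ a real number and $u=(u_1,\dots,u_n)$ a vector of positive integers. The mixed-integer bilinear covering set with bounds is $$S^U=\Big\{(x,y)\in\mathbb{Z}^n_+\times\mathbb{R}^n_+ : \sum_{i=1}^n x_iy_i\ge r,\ x\le u\Big\},$$ where $\mathbb{R}_+=[0,\infty)$ and $\mathbb{Z}_+=\mathbb{Z}\cap[0,\infty)$. Inequalities between vectors are componentwise. For $i\in N$, $\mathcal{L}(i,x_i,y_i)$ denotes the point $(x,y)\in\mathbb{R}^n\times\mathbb{R}^n$ whose $i$-th $x$- and $y$-components are $x_i$ and $y_i$, and with $x_j=y_j=0$ for all $j\ne i$. Put $\bar u_i=r/u_i$ and define $$S^L_i=\{\mathcal{L}(i,x_i,y_i)\in\mathbb{Z}^n_+\times\mathbb{R}^n_+ : x_iy_i\ge r,\ y_i\ge\bar u_i\},\qquad S^L=\bigcup_{i=1}^n S^L_i .$$ $conv$ denotes convex hull and $cl$ denotes closure in $\mathbb{R}^n\times\mathbb{R}^n$. *)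

(* Defs.v *)
From HB Require Import structures.
From mathcomp Require Import all_boot all_order all_algebra.
From mathcomp Require Import all_classical all_reals all_analysis.

Set Implicit Arguments.
Unset Strict Implicit.
Unset Printing Implicit Defensive.

Import Order.TTheory GRing.Theory Num.Theory.
Import numFieldNormedType.Exports.

Local Open Scope classical_set_scope.
Local Open Scope ring_scope.

Definition convex_hull (R : numDomainType) (M : lmodType R) (A : set M)
  : set M := smallest (@convex_set R M) A.

(* Z_+^n x R_+^n, seen inside R^n x R^n so that hulls and closures are taken
   in the latter *)
Definition mixed_orthant (R : realType) (n : nat)
    : set ('rV[R]_n * 'rV[R]_n) :=
  [set p : 'rV[R]_n * 'rV[R]_n | forall i : 'I_n,
     [/\ p.1 ord0 i \is a Num.int, 0 <= p.1 ord0 i & 0 <= p.2 ord0 i]].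

Definition x_bounded (R : realType) (n : nat) (u : 'I_n -> nat)
    (p : 'rV[R]_n * 'rV[R]_n) : Prop :=
  forall i : 'I_n, p.1 ord0 i <= (u i)%:R.

Definition covering_set (R : realType) (n : nat) (r : R) (u : 'I_n -> nat)
    : set ('rV[R]_n * 'rV[R]_n) :=
  [set p : 'rV[R]_n * 'rV[R]_n | [/\ mixed_orthant p,
     r <= \sum_(i < n) p.1 ord0 i * p.2 ord0 i & x_bounded u p]].

Definition axis_point (R : realType) (n : nat) (i : 'I_n) (a b : R)
    : 'rV[R]_n * 'rV[R]_n :=
  (\row_j (if j == i then a else 0), \row_j (if j == i then b else 0)).

(* There is no bound x_i <= u_i, the vector u enters only through
   y_i >= r / u_i *)
Definition axis_set (R : realType) (n : nat) (r : R) (u : 'I_n -> nat)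
    (i : 'I_n) : set ('rV[R]_n * 'rV[R]_n) :=
  [set p : 'rV[R]_n * 'rV[R]_n | exists a b : R,
     [/\ p = axis_point i a b, mixed_orthant p, r <= a * b & r / (u i)%:R <= b]].

Definition axis_union (R : realType) (n : nat) (r : R) (u : 'I_n -> nat)
    : set ('rV[R]_n * 'rV[R]_n) :=
  \bigcup_(i : 'I_n) axis_set r u i.

(* Main.v *)
Require Import Defs.
From HB Require Import structures.
From mathcomp Require Import all_boot all_order all_algebra.
From mathcomp Require Import all_classical all_reals all_analysis.
From mathcomp Require Import ring lra.
Set Implicit Arguments.
Unset Strict Implicit.
Unset Printing Implicit Defensive.
Import Order.TTheory GRing.Theory Num.Theory.
Import numFieldNormedType.Exports.
Local Open Scope classical_set_scope.
Local Open Scope ring_scope.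

(** Write C for the closed convex hull of the union of the axis sets.

    The covering set lies in C: if the bilinear sum of a point (x, y) is
    s >= r, then (x, y) dominates the convex combination, with weights
    x_i y_i / s, of the axis points carrying (x_i, s / x_i), and C is closed
    under increasing coordinates, because each axis set contains arbitrarily
    long integer translates of one of its points along both of its coordinate
    directions and C is closed ([closed_convex_recession],
    [closure_upward_closed]).

    Conversely, call hyperbola points of index i the planar points (k, b) with k
    integer, 1 <= k <= u_i and k b >= r. Within x_i <= u_i, their convex hull is
    cut out by finitely many inequalities: x_i >= 1, one chord for each pair of
    consecutive abscissas k, k + 1 with 1 <= k < u_i, and y_i >= r / u_i.
    Normalize each of them as 1 <= l_k(x_i, y_i) with l_k linear ([facet]). For
    every choice of one index k_i per coordinate, the inequality
    1 <= \sum_i l_(k_i)(x_i, y_i) holds on the axis sets, hence on C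
    ([closure_facet_sum_ge1]). Choosing each k_i so as to minimize l_k at a
    given point of C and rescaling yields weights mu_i >= 0 of sum 1 with
    mu_i <= l_k(x_i, y_i) for all i, k.

    These weights drive the decomposition. With x_i <= u_i, each (x_i, y_i)
    splits as mu_i z_i + (1 - mu_i) w_i, where z_i is in the hull of the
    hyperbola points as soon as mu_i > 0, and w_i is in the strip
    [0, u_i] x [0, +oo) ([facet_split]). The point is therefore
    \sum_j mu_j q_j, where q_j has z_j as its j-th coordinate pair and w_i as
    the others. A point whose j-th pair is a hyperbola point and whose other
    pairs are points of the strips with integer abscissa is in the covering set;
    as these conditions bear on separate coordinate pairs, hulls can be taken
    pair by pair ([convex_hull_product]), and q_j is in the convex hull of the
    covering set whenever mu_j > 0. *)

(** * Convex hulls and closures *)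

Lemma convex_setP (R : numDomainType) (M : lmodType R) (A : set M) :
  convex_set A <-> forall x y t, 0 <= t -> t <= 1 -> A x -> A y ->
    A (t *: x + (1 - t) *: y).
Proof.
split=> [cA x y t t0 t1 Ax Ay|cA x y t /set_mem Ax /set_mem Ay].
  by have := cA x y (Itv01 t0 t1); rewrite !inE; apply.
by apply/mem_set; exact: cA.
Qed.

Lemma convex_hull_sub (R : numDomainType) (M : lmodType R) (A B : set M) :
  convex_set B -> A `<=` B -> convex_hull A `<=` B.
Proof. by move=> cB AB; exact: smallest_sub. Qed.

Lemma sub_convex_hull (R : numDomainType) (M : lmodType R) (A : set M) :
  A `<=` convex_hull A.
Proof. exact: sub_gen_smallest. Qed.

Lemma convex_convex_hull (R : numDomainType) (M : lmodType R) (A : set M) :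
  convex_set (convex_hull A).
Proof.
apply/convex_setP => x y t t0 t1 Ax Ay B [cB AB].
by apply: (convex_setP B).1 => //; [apply: Ax|apply: Ay].
Qed.

Lemma convex_closure (R : realType) (V : normedModType R) (A : set V) :
  convex_set A -> convex_set (closure A).
Proof.
move=> /convex_setP cA; apply/convex_setP => x y t t0 t1 Ax Ay B Bz.
have : (fun pq : V * V => t *: pq.1 + (1 - t) *: pq.2) @ (x, y) -->
    t *: x + (1 - t) *: y.
  apply: cvgD; apply: cvgZl_tmp; [exact: cvg_fst|exact: cvg_snd].
case/(_ B Bz) => -[U W] /= [Ux Wy] UWB.
have [a [Aa Ua]] := Ax U Ux; have [b [Ab Wb]] := Ay W Wy.
by exists (t *: a + (1 - t) *: b); split; [exact: cA | exact: (UWB (a, b))].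
Qed.

(** Membership is asked only at positive weights: in the combinations formed
    below, the natural point of an index of weight zero may lie outside A. *)
Lemma convex_sum (R : realFieldType) (M : lmodType R) (A : set M) (I : finType)
    (l : I -> R) (q : I -> M) :
  convex_set A -> (forall i, 0 <= l i) -> \sum_i l i = 1 ->
  (forall i, 0 < l i -> A (q i)) -> A (\sum_i l i *: q i).
Proof.
move=> /convex_setP cA l0 l1 Aq.
(* partial sums are normalized by their total weight, which may be zero *)
have gen (s : seq I) : exists2 a, (0 < \sum_(i <- s) l i -> A a) &
    \sum_(i <- s) l i *: q i = (\sum_(i <- s) l i) *: a.
  elim: s => [|i s [a Aa sE]]; first by exists 0; rewrite !big_nil ?ltxx ?scaler0.
  rewrite !big_cons sE; set L := \sum_(j <- s) l j in Aa *.
  have L0 : 0 <= L by exact: sumr_ge0.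
  have [li0|li0] := eqVneq (l i) 0.
    by exists a; rewrite li0 ?scale0r !add0r.
  have li_gt0 : 0 < l i by rewrite lt0r li0 l0.
  have T0 : 0 < l i + L by rewrite ltr_pwDl.
  have [LE|LN0] := eqVneq L 0.
    by exists (q i) => [_|]; [exact: Aq | rewrite LE scale0r !addr0].
  exists ((l i / (l i + L)) *: q i + (1 - l i / (l i + L)) *: a) => [_|].
    apply: cA; rewrite ?divr_ge0 ?(ltW T0)//; last 1 first.
    - by apply: Aa; rewrite lt0r LN0.
    - by rewrite ler_pdivrMr// mul1r lerDl.
    - exact: Aq.
  rewrite scalerDr !scalerA mulrBr mulr1 (mulrC (l i + L)) divfK ?gt_eqF//.
  by rewrite (addrC (l i)) addrK.
by have [a] := gen (index_enum I); rewrite l1 scale1r => + ->; apply; exact: ltr01.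
Qed.

(** Mixing q with weight s / m of a far point p + m d moves q by s d, up to an
    error of order 1 / m. Translates by integer multiples suffice, and they may
    start from a point p unrelated to q. *)
Lemma closed_convex_recession (R : realType) (V : normedModType R) (C : set V)
    (q p d : V) (s : R) :
  closed C -> convex_set C -> C q -> (forall m : nat, C (p + m%:R *: d)) ->
  0 <= s -> C (q + s *: d).
Proof.
move=> clC /convex_setP cC Cq Cp s0.
pose v m := q + s *: d + harmonic m *: (s *: (p - q)).
apply: (@closed_cvg _ _ \oo _ v C clC).
  near=> m; rewrite /v /harmonic.
  have sm : s <= m.+1%:R.
    by apply: (@le_trans _ _ m%:R); [near: m; exact: nbhs_infty_ger|rewrite ler_nat].
  have -> : q + s *: d + m.+1%:R^-1 *: (s *: (p - q)) =
      (s / m.+1%:R) *: (p + m.+1%:R *: d) + (1 - s / m.+1%:R) *: q.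
    rewrite !scalerBr scalerDr !scalerA divfK ?pnatr_eq0// scalerBl scale1r.
    rewrite (mulrC _^-1); set a := _ *: p; set b := _ *: q; set c := _ *: d.
    by rewrite addrACA [RHS]addrC [RHS]addrACA (addrC c).
  apply: cC => //; first by rewrite divr_ge0.
  by rewrite ler_pdivrMr ?mul1r.
rewrite -[X in _ --> X]addr0 -[X in _ --> _ + X](scale0r (s *: (p - q))).
apply: cvgD; first exact: cvg_cst.
by apply: cvgZr_tmp; exact: cvg_harmonic.
Unshelve. all: by end_near.
Qed.

(** An affine inequality cuts out a closed half-space, so that it passes from a
    set to its closed convex hull. *)
Lemma closure_convex_hull_ge (R : realType) (V : normedModType R) (phi : V -> R)
    (c : R) (A : set V) (p : V) :
  continuous phi ->
  (forall x y t, phi (t *: x + (1 - t) *: y) = t * phi x + (1 - t) * phi y) ->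
  (forall x, A x -> c <= phi x) ->
  closure (convex_hull A) p -> c <= phi p.
Proof.
move=> phiC phiA Age; have clH : closed [set x | c <= phi x].
  by apply: (@preimage_closed _ _ phi [set y | c <= y]).
suff sub : convex_hull A `<=` [set x | c <= phi x].
  by move=> /(closureS sub) /clH.
apply: convex_hull_sub => //; apply/convex_setP => x y t t0 t1 /= cx cy.
rewrite phiA -[c]mul1r -{1}(subrKC t 1) mulrDl.
by rewrite lerD// ler_wpM2l// subr_ge0.
Qed.

(** * Points as families of coordinate pairs *)

Section coordinates.
Variables (R : realType) (n : nat).
Implicit Types (z : 'I_n -> R^o * R^o) (p : 'rV[R]_n * 'rV[R]_n).

Definition of_coords z : 'rV[R]_n * 'rV[R]_n :=
  (\row_j (z j).1, \row_j (z j).2).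

Definition coords p (j : 'I_n) : R^o * R^o := (p.1 ord0 j, p.2 ord0 j).

Lemma coordsK p : of_coords (coords p) = p.
Proof.
by case: p => x y; congr pair; apply/rowP => j; rewrite mxE.
Qed.

Lemma coords_combination (I : finType) (l : I -> R) (q : I -> 'rV[R]_n * 'rV[R]_n)
    j :
  coords (\sum_i l i *: q i) j = \sum_i l i *: coords (q i) j.
Proof.
have add : {morph coords^~ j : p p' / p + p'}.
  by move=> p p'; congr pair; rewrite /= mxE.
rewrite (big_morph (coords^~ j) add (id1 := 0)).
  by apply: eq_bigr => i _; congr pair; rewrite /= mxE.
by congr pair; rewrite /= mxE.
Qed.

Lemma fst_coord_continuous (i : 'I_n) :
  continuous (fun p : 'rV[R]_n * 'rV[R]_n => p.1 ord0 i).
Proof.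
by move=> p; apply: (@continuous_comp _ _ _ fst (fun M : 'rV[R]_n => M ord0 i));
  [exact: cvg_fst | exact: coord_continuous].
Qed.

Lemma snd_coord_continuous (i : 'I_n) :
  continuous (fun p : 'rV[R]_n * 'rV[R]_n => p.2 ord0 i).
Proof.
by move=> p; apply: (@continuous_comp _ _ _ snd (fun M : 'rV[R]_n => M ord0 i));
  [exact: cvg_snd | exact: coord_continuous].
Qed.

Lemma of_coordsK z : coords (of_coords z) =1 z.
Proof. by move=> i; rewrite /coords /= !mxE; case: (z i). Qed.

Lemma coords_inj p p' : coords p =1 coords p' -> p = p'.
Proof. by move=> /funext E; rewrite -[p]coordsK -[p']coordsK E. Qed.

Lemma coords_axis_point (i : 'I_n) (a b : R) j :
  coords (axis_point i a b) j = if j == i then (a, b) else 0.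
Proof. by rewrite /coords /= !mxE; case: ifP. Qed.

Lemma scale_axis_point (i : 'I_n) (l a b : R) :
  l *: axis_point i a b = axis_point i (l * a) (l * b).
Proof.
apply: coords_inj => j; rewrite coords_axis_point /coords /= !mxE.
by case: ifP => _; rewrite ?mulr0.
Qed.

Lemma sum_axis_point z :
  \sum_i axis_point i (z i).1 (z i).2 = of_coords z.
Proof.
apply: coords_inj => j; rewrite of_coordsK.
under eq_bigr do rewrite -[axis_point _ _ _]scale1r.
rewrite coords_combination (bigD1 j)//= big1 => [|i /negPf ij].
  by rewrite coords_axis_point eqxx addr0 scale1r; case: (z j).
by rewrite coords_axis_point eq_sym ij scaler0.
Qed.

(** The coordinate pairs are relaxed from A i to its hull one index at a time:
    with the other pairs fixed, the values of one pair that keep the point in H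
    form a convex set of the plane. *)
Lemma convex_hull_product (A : 'I_n -> set (R^o * R^o))
    (H : set ('rV[R]_n * 'rV[R]_n)) z :
  convex_set H -> (forall w, (forall i, A i (w i)) -> H (of_coords w)) ->
  (forall i, convex_hull (A i) (z i)) -> H (of_coords z).
Proof.
move=> cH AH.
have gen (s : seq 'I_n) : forall w,
    (forall i, i \in s -> convex_hull (A i) (w i)) ->
    (forall i, i \notin s -> A i (w i)) -> H (of_coords w).
  elim: s => [|i s IH] w ws wNs; first by apply: AH => i; exact: wNs.
  pose upd v j := if j == i then v else w j.
  suff sub : convex_hull (A i) `<=` [set v | H (of_coords (upd v))].
    have -> : w = upd (w i) by apply/funext => j; rewrite /upd; case: eqP => [->|].
    by apply: sub; apply: ws; rewrite mem_head.
  apply: convex_hull_sub => [|v Av].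
    apply/convex_setP => v v' t t0 t1 Hv Hv' /=.
    have -> : of_coords (upd (t *: v + (1 - t) *: v')) =
        t *: of_coords (upd v) + (1 - t) *: of_coords (upd v').
      by congr pair; apply/rowP => j; rewrite !mxE /upd; case: ifP => _ //=;
        rewrite -mulrDl subrKC mul1r.
    exact: (convex_setP H).1.
  apply: IH => j js; rewrite /upd; case: eqP => [->|/eqP ji].
  - exact: sub_convex_hull.
  - by apply: ws; rewrite inE js orbT.
  - by [].
  - by apply: wNs; rewrite inE negb_or ji.
by move=> Az; apply: (gen (enum 'I_n)) => // i; rewrite mem_enum.
Qed.

End coordinates.

(** * The planar lattice hyperbola and its facets *)

Section plane.
Variable R : realType.
Implicit Types (r a b x y mu : R) (u k : nat).

Lemma nat_bracket a u : 0 <= a -> a <= u%:R ->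
  a = u%:R \/ exists2 k, (k < u)%N & k%:R <= a < k.+1%:R.
Proof.
move=> a0; rewrite le_eqVlt => /orP[/eqP ->|au]; first by left.
right; have ka := truncn_itv a0; exists (Num.truncn a) => //.
by rewrite -(ltr_nat R); apply: le_lt_trans au; case/andP: ka.
Qed.

Definition lattice_strip u : set (R^o * R^o) :=
  [set z | exists k, [/\ (k <= u)%N, z.1 = k%:R & 0 <= z.2]].

Definition lattice_hyperbola r u : set (R^o * R^o) :=
  [set z | exists k, [/\ (0 < k)%N, (k <= u)%N, z.1 = k%:R & r <= k%:R * z.2]].

Lemma hull_lattice_strip u a b :
  0 <= a -> a <= u%:R -> 0 <= b -> convex_hull (lattice_strip u) (a, b).
Proof.
move=> a0 au b0; have [->|[k ku /andP[ka ak]]] := nat_bracket a0 au.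
  by apply: sub_convex_hull; exists u.
have -> : (a, b) = (a - k%:R) *: ((k.+1%:R, b) : R^o * R^o) +
    (1 - (a - k%:R)) *: ((k%:R, b) : R^o * R^o).
  by congr pair; rewrite /= /GRing.scale /= -?natr1; ring.
have /convex_setP cvx := @convex_convex_hull R _ (lattice_strip u).
apply: cvx.
- by rewrite subr_ge0.
- by move: ak; rewrite -natr1; lra.
- by apply: sub_convex_hull; exists k.+1.
- by apply: sub_convex_hull; exists k; rewrite (ltnW ku).
Qed.

(** A point above all chords is above the chord over its own unit interval
    [k, k + 1]; raising both ends of that chord by the same amount reaches it. *)
Lemma hull_lattice_hyperbola r u a b :
  0 < r -> 1 <= a -> a <= u%:R -> r <= u%:R * b ->
  (forall k, (k < u)%N ->
     r * (k%:R + k.+1%:R) <= r * a + k%:R * k.+1%:R * b) ->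
  convex_hull (lattice_hyperbola r u) (a, b).
Proof.
move=> r0 a1 au rub chord.
have a0 : 0 <= a by exact: le_trans a1.
have [aE|[k ku /andP[ka ak]]] := nat_bracket a0 au.
  apply: sub_convex_hull; exists u; split => //.
  by rewrite -(ltr_nat R) -aE (lt_le_trans ltr01).
have k0 : (0 < k)%N by rewrite -ltnS -(ltr_nat R) (le_lt_trans a1).
have K0 : 0 < k%:R :> R by rewrite ltr0n.
have := chord _ ku; move: ak; rewrite -natr1; set K := k%:R in ka K0 *.
move=> ak rab; pose t := a - K.
(* height of (a, b) above the chord joining (K, r / K) and (K + 1, r / (K + 1)) *)
pose d := b - ((1 - t) * (r / K) + t * (r / (K + 1))).
have d0 : 0 <= d.
  have -> : d = (r * a + K * (K + 1) * b - r * (K + (K + 1))) / (K * (K + 1)).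
    by rewrite /d /t; field; lra.
  by rewrite divr_ge0 ?subr_ge0// mulr_ge0; lra.
have -> : (a, b) = t *: ((K + 1, r / (K + 1) + d) : R^o * R^o) +
    (1 - t) *: ((K, r / K + d) : R^o * R^o).
  by congr pair; rewrite /= /GRing.scale /= /d /t; ring.
have /convex_setP cvx := @convex_convex_hull R _ (lattice_hyperbola r u).
apply: cvx.
- by rewrite subr_ge0.
- by rewrite /t; lra.
- apply: sub_convex_hull; exists k.+1; rewrite -natr1 -/K; split => //=.
  by rewrite mulrDr mulrC divfK ?lerDl ?mulr_ge0//; lra.
- apply: sub_convex_hull; exists k; rewrite -/K; split => //=; first exact: ltnW.
  by rewrite mulrDr mulrC divfK ?lerDl ?mulr_ge0//; lra.
Qed.

(** The line facet = 1 passes through the points of abscissas k and k + 1 of the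
    hyperbola a * b = r when 0 < k < u. It is the vertical line a = 1 when
    k = 0 < u, and the horizontal line b = r / u when k >= u. *)
Definition facet r u k a b : R :=
  if (k < u)%N then (r * a + k%:R * k.+1%:R * b) / (r * (k%:R + k.+1%:R))
  else u%:R * b / r.

Lemma facet_ge0 r u k a b : 0 < r -> 0 <= a -> 0 <= b -> 0 <= facet r u k a b.
Proof.
move=> r0 a0 b0; have := ltW r0 => r0'; rewrite /facet; case: ifP => _.
  by rewrite divr_ge0 ?addr_ge0 ?mulr_ge0 ?addr_ge0.
by rewrite divr_ge0 ?mulr_ge0.
Qed.

(** After multiplication by m, the chord inequality at an integer abscissa m
    reduces to (m - k) (m - k - 1) >= 0: the consecutive integers k and k + 1
    have no integer strictly between them. *)
Lemma facet_ge1 r u k m b : 0 < r -> r <= m%:R * b -> r <= u%:R * b ->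
  1 <= facet r u k m%:R b.
Proof.
move=> r0 rmb rub; rewrite /facet; case: ifP => _; last by rewrite ler_pdivlMr ?mul1r.
have m0 : 0 < m%:R :> R.
  by case: m rmb => [|m]; rewrite ?mul0r ?ltr0n// leNgt r0.
have K0 : 0 <= k%:R :> R by [].
have mk : 0 <= (m%:R - k%:R) * (m%:R - (k%:R + 1)) :> R.
  have [km|mk] := ltnP k m.
    have : k.+1%:R <= m%:R :> R by rewrite ler_nat.
    by rewrite -natr1 => ?; rewrite mulr_ge0; lra.
  have : m%:R <= k%:R :> R by rewrite ler_nat.
  by move=> ?; rewrite mulr_le0; lra.
rewrite ler_pdivlMr ?mul1r; last by rewrite -natr1 mulr_gt0; lra.
rewrite -natr1 -(ler_pM2l m0); move: (m%:R) (k%:R) m0 K0 mk rmb => M K M0 K0 mk rmb.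
have : K * (K + 1) * r <= K * (K + 1) * (M * b).
  by apply: ler_wpM2l => //; rewrite mulr_ge0; lra.
have : 0 <= r * ((M - K) * (M - (K + 1))) by rewrite mulr_ge0; lra.
lra.
Qed.

Lemma facet_continuous r u k (T : topologicalType) (f g : T -> R) :
  continuous f -> continuous g -> continuous (fun t => facet r u k (f t) (g t)).
Proof.
move=> cf cg t; rewrite /facet; case: (k < u)%N.
  by apply: cvgMr_tmp; apply: cvgD; apply: cvgMl_tmp; [exact: cf | exact: cg].
by apply: cvgMr_tmp; apply: cvgMl_tmp; exact: cg.
Qed.

(** By homogeneity, when mu > 0 the bounds on mu say that (x, y) is mu times a
    point above all facets. If its abscissa x / mu exceeds u, it is truncated to u, which
    stays above the facets thanks to the bound b >= r / u, and the excess
    x - mu u goes into the strip: it is at most (1 - mu) u because x <= u. *)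
Lemma facet_split r u x y mu : 0 < r -> (0 < u)%N ->
  0 <= x -> x <= u%:R -> 0 <= y -> 0 <= mu -> mu <= 1 ->
  (forall k, (k <= u)%N -> mu <= facet r u k x y) ->
  exists z w : R^o * R^o, [/\ mu *: z + (1 - mu) *: w = (x, y),
    0 < mu -> convex_hull (lattice_hyperbola r u) z &
    convex_hull (lattice_strip u) w].
Proof.
move=> r0 u0 x0 xu y0 mu0 mu1 mul.
have [mu_eq0|mu_neq0] := eqVneq mu 0.
  exists 0, (x, y); split; last exact: hull_lattice_strip.
    by rewrite mu_eq0 scale0r add0r subr0 scale1r.
  by rewrite mu_eq0 ltxx.
have mu_gt0 : 0 < mu by rewrite lt0r mu_neq0.
(* the horizontal facet, of index k = u *)
have muy : r <= u%:R * (y / mu).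
  have := mul u (leqnn u); rewrite /facet ltnn ler_pdivlMr// => h.
  by rewrite mulrA ler_pdivlMr// mulrC.
have [xmu|mux] := leP x (mu * u%:R).
  exists (x / mu, y / mu), 0; split; last exact: hull_lattice_strip.
    by congr pair; rewrite /= /GRing.scale /=; field.
  have chord k : (k < u)%N ->
      r * (k%:R + k.+1%:R) <= r * (x / mu) + k%:R * k.+1%:R * (y / mu).
    move=> ku; have := mul k (ltnW ku); rewrite /facet ku.
    rewrite ler_pdivlMr ?mulr_gt0 ?ltr_wpDl ?ltr0n// => h.
    by rewrite 2!mulrA -mulrDl ler_pdivlMr// mulrC.
  move=> _; apply: hull_lattice_hyperbola => //.
    (* the facet of index 0 bounds the abscissa below by 1 *)
    by have := chord 0%N u0; rewrite !mul0r !add0r addr0 mulr1 ler_pMr.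
  by rewrite ler_pdivrMr// mulrC.
have U0 : 0 < u%:R :> R by rewrite ltr0n.
have mu_lt1 : mu < 1.
  by rewrite -(ltr_pM2r U0) mul1r (lt_le_trans mux).
exists (u%:R, y / mu), ((x - mu * u%:R) / (1 - mu), 0); split.
- by congr pair; rewrite /= /GRing.scale /=; field; lra.
- by move=> _; apply: sub_convex_hull; exists u.
- apply: hull_lattice_strip => //.
    by rewrite divr_ge0; lra.
  by rewrite ler_pdivrMr; lra.
Qed.

End plane.

(** * The two inclusions *)

Section hulls.
Variables (R : realType) (n : nat) (r : R) (u : 'I_n -> nat).
Hypotheses (r_gt0 : 0 < r) (u_gt0 : forall i : 'I_n, (0 < u i)%N).
Implicit Types p q : 'rV[R]_n * 'rV[R]_n.

Local Notation C := (closure (convex_hull (axis_union r u))).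

Lemma convex_axis_closure : convex_set C.
Proof. by apply: (convex_closure (@convex_convex_hull R _ (axis_union r u))). Qed.

Lemma axis_union_point (i : 'I_n) (m : nat) (b : R) :
  r <= m%:R * b -> r / (u i)%:R <= b -> axis_union r u (axis_point i m%:R b).
Proof.
move=> rmb rub; exists i => //; exists m%:R, b; split=> // j; rewrite !mxE /=.
have b0 : 0 <= b by apply: (le_trans _ rub); rewrite divr_ge0 // ltW.
by case: ifP => _; split; rewrite ?natr_int.
Qed.

Lemma axis_union_sub_closure : axis_union r u `<=` C.
Proof. by move=> p /sub_convex_hull; exact: subset_closure. Qed.

(** The i-th axis set contains the points carrying (1 + m, r) and (1, r + m) for
    all natural m, so both coordinate directions of index i are recession
    directions. *)
Lemma closure_add_axis_point q (i : 'I_n) (a b : R) :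
  C q -> 0 <= a -> 0 <= b -> C (q + axis_point i a b).
Proof.
move=> Cq a0 b0.
have r0 := ltW r_gt0.
have ui1 : 1 <= (u i)%:R :> R by rewrite ler1n.
have rui : r / (u i)%:R <= r by rewrite ler_pdivrMr ?(lt_le_trans ltr01)// ler_peMr.
have addE (a1 b1 a2 b2 : R) : axis_point i a1 b1 + axis_point i a2 b2 =
    axis_point i (a1 + a2) (b1 + b2).
  apply: coords_inj => j; rewrite coords_axis_point /coords /= !mxE.
  by case: ifP => _; rewrite ?addr0.
have -> : axis_point i a b = a *: axis_point i 1 0 + b *: axis_point i 0 1.
  by rewrite !scale_axis_point addE !mulr0 !mulr1 addr0 add0r.
have rec d : (forall m : nat, C (axis_point i 1 r + m%:R *: d)) ->
    forall p s, C p -> 0 <= s -> C (p + s *: d).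
  move=> Cd p s Cp s0.
  have cC : closed C by exact: closed_closure.
  exact: (closed_convex_recession cC convex_axis_closure Cp Cd s0).
rewrite addrA; apply: (rec (axis_point i 0 1)) => // [m|].
  rewrite scale_axis_point addE mulr0 mulr1 addr0.
  apply/axis_union_sub_closure/(@axis_union_point _ 1).
    by rewrite mul1r lerDl.
  by apply: (le_trans rui); rewrite lerDl.
apply: (rec (axis_point i 1 0)) => // m.
rewrite scale_axis_point addE mulr0 mulr1 addr0.
rewrite addrC natr1; apply/axis_union_sub_closure/axis_union_point => //.
by rewrite ler_peMl// ler1n.
Qed.

Lemma closure_upward_closed q p : C q ->
  (forall i, q.1 ord0 i <= p.1 ord0 i) -> (forall i, q.2 ord0 i <= p.2 ord0 i) ->
  C p.
Proof.
move=> Cq qp1 qp2.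
have -> : p = q + \sum_i axis_point i (coords (p - q) i).1 (coords (p - q) i).2.
  by rewrite sum_axis_point coordsK addrC subrK.
elim/big_rec: _ => [|i v _ Cv]; first by rewrite addr0.
by rewrite addrCA addrC; apply: closure_add_axis_point; rewrite //= !mxE subr_ge0.
Qed.

Lemma covering_set_sub_closure : covering_set r u `<=` C.
Proof.
move=> p [po rs pu]; set s := \sum_i _ in rs.
have s0 : 0 < s by exact: lt_le_trans rs.
pose l i := p.1 ord0 i * p.2 ord0 i / s.
pose q i := axis_point i (p.1 ord0 i) (s / p.1 ord0 i).
have l0 i : 0 <= l i by have [_ ? ?] := po i; rewrite divr_ge0 ?mulr_ge0// ltW.
have l1 : \sum_i l i = 1 by rewrite -mulr_suml divff// gt_eqF.
(* a positive weight forces x_i > 0, so that s / x_i is a true quotient *)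
have Cq : C (\sum_i l i *: q i).
  apply: (convex_sum convex_axis_closure) => // i li0.
  apply/axis_union_sub_closure.
  have [xint x0 y0] := po i.
  have x_neq0 : p.1 ord0 i != 0.
    by apply: contraTneq li0; rewrite /l => ->; rewrite !mul0r ltxx.
  have x_gt0 : 0 < p.1 ord0 i by rewrite lt0r x_neq0.
  rewrite /q; have := xint; rewrite intrEge0// => /natrP[m xm].
  rewrite xm in x_gt0 x_neq0 *; apply: axis_union_point.
    by rewrite mulrC divfK.
  apply: ler_pM => //; rewrite ?invr_ge0 ?(ltW r_gt0)//.
  by rewrite lef_pV2 ?posrE// ?ltr0n// -xm; exact: pu.
move: Cq; rewrite /q; under eq_bigr do rewrite scale_axis_point.
rewrite (sum_axis_point
  (fun i => (l i * p.1 ord0 i, l i * (s / p.1 ord0 i)) : R^o * R^o)) => Cq.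
apply: (closure_upward_closed Cq) => i; rewrite mxE /=; have [_ x0 y0] := po i.
  rewrite ler_piMl// -l1 (bigD1 i)//= lerDl; exact: sumr_ge0.
have [x_eq0|x_neq0] := eqVneq (p.1 ord0 i) 0.
  by rewrite /l x_eq0 !mul0r.
have -> // : l i * (s / p.1 ord0 i) = p.2 ord0 i.
by rewrite /l; field; rewrite x_neq0 gt_eqF.
Qed.

Lemma closure_nonneg p : C p -> forall i, 0 <= p.1 ord0 i /\ 0 <= p.2 ord0 i.
Proof.
move=> Cp i; split.
- apply: (closure_convex_hull_ge (@fst_coord_continuous _ _ i) _ _ Cp).
    by move=> x y t; rewrite !mxE.
  by move=> x [j _ [a [b [_ xo _ _]]]]; have [] := xo i.
- apply: (closure_convex_hull_ge (@snd_coord_continuous _ _ i) _ _ Cp).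
    by move=> x y t; rewrite !mxE.
  by move=> x [j _ [a [b [_ xo _ _]]]]; have [] := xo i.
Qed.

(** Quantifying over all choices f of one facet per index expresses that the sum
    over i of the minima over k of the facets is at least 1, while involving
    only half-spaces. On an axis point a single summand is nonzero. *)
Lemma closure_facet_sum_ge1 p (f : 'I_n -> nat) : C p ->
  1 <= \sum_i facet r (u i) (f i) (p.1 ord0 i) (p.2 ord0 i).
Proof.
pose phi p := \sum_i facet r (u i) (f i) (p.1 ord0 i) (p.2 ord0 i).
move=> Cp; apply: (@closure_convex_hull_ge _ _ phi _ _ _ _ _ _ Cp).
- apply: continuous_big => [|i _]; first exact: add_continuous.
  by apply: facet_continuous; [exact: fst_coord_continuous|exact: snd_coord_continuous].
- move=> x y t; rewrite /phi !mulr_sumr -big_split; apply: eq_bigr => i _ /=.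
  by rewrite !mxE /facet; case: ifP => _; ring.
- move=> x [i _ [a [b [-> xo rab rub]]]].
  have b0 : 0 <= b by have [_ _] := xo i; rewrite mxE eqxx.
  have [] := xo i; rewrite mxE eqxx => aint a0 _.
  move: aint; rewrite intrEge0// => /natrP[m am]; rewrite am in a0 rab *.
  rewrite /phi (bigD1 i)//= !mxE eqxx; apply: ler_wpDr.
    by apply: sumr_ge0 => j /negPf ji; rewrite !mxE ji facet_ge0.
  by apply: facet_ge1 => //; rewrite mulrC -ler_pdivrMr ?ltr0n.
Qed.

Lemma closure_bounded_sub_hull p : C p -> x_bounded u p ->
  convex_hull (covering_set r u) p.
Proof.
move=> Cp pu; have p0 := closure_nonneg Cp.
pose g i (k : 'I_(u i).+1) := facet r (u i) k (p.1 ord0 i) (p.2 ord0 i).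
pose kmin i := [arg min_(k < ord0) g i k]%O.
pose l i := g i (kmin i).
have lmin i k : (k <= u i)%N -> l i <= facet r (u i) k (p.1 ord0 i) (p.2 ord0 i).
  rewrite -ltnS => ku; rewrite /l /kmin; case: arg_minP => // k0 _ /(_ (Ordinal ku)).
  exact.
have l0 i : 0 <= l i by have [? ?] := p0 i; exact: facet_ge0.
have s1 : 1 <= \sum_i l i by exact: closure_facet_sum_ge1 (fun i => kmin i : nat) Cp.
set s := \sum_i l i in s1; have s0 : 0 < s by exact: lt_le_trans s1.
pose mu i := l i / s.
have mu0 i : 0 <= mu i by rewrite divr_ge0// ltW.
have mu_sum : \sum_i mu i = 1 by rewrite -mulr_suml divff// gt_eqF.
have mu1 i : mu i <= 1.
  by rewrite -mu_sum (bigD1 i)//= lerDl sumr_ge0.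
have mul i k : (k <= u i)%N ->
    mu i <= facet r (u i) k (p.1 ord0 i) (p.2 ord0 i).
  by move=> /lmin; apply: le_trans; rewrite ler_pdivrMr// ler_peMr.
have /choice[zw zwP] : forall i, exists zw : (R^o * R^o) * (R^o * R^o),
    [/\ mu i *: zw.1 + (1 - mu i) *: zw.2 = coords p i,
      0 < mu i -> convex_hull (lattice_hyperbola r (u i)) zw.1 &
      convex_hull (lattice_strip (u i)) zw.2].
  move=> i; have [x0 y0] := p0 i.
  have [z [w zwP]] :=
    facet_split r_gt0 (u_gt0 i) x0 (pu i) y0 (mu0 i) (mu1 i) (mul i).
  by exists (z, w).
pose q j := of_coords (fun i => if i == j then (zw i).1 else (zw i).2).
have -> : p = \sum_j mu j *: q j.
  apply: coords_inj => i; rewrite coords_combination (bigD1 i)//= /q.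
  rewrite of_coordsK eqxx.
  under eq_bigr => j ji do rewrite of_coordsK eq_sym (negPf ji).
  have [<- _ _] := zwP i; rewrite -scaler_suml -mu_sum [in LHS](bigD1 i)//=.
  by rewrite [mu i + _]addrC addrK.
apply: convex_sum => // [|j muj]; first exact: convex_convex_hull.
(* the j-th pair alone secures the bilinear bound r *)
pose A i := if i == j then lattice_hyperbola r (u i) else lattice_strip (u i).
apply: (@convex_hull_product _ _ A); first exact: convex_convex_hull.
  move=> w wA; apply: sub_convex_hull.
  have wS i : [/\ (w i).1 \is a Num.int, 0 <= (w i).1, (w i).1 <= (u i)%:R &
      0 <= (w i).2].
    move: (wA i); rewrite /A; case: ifP => _ [k []].
      move=> k0 ku -> rk; split; rewrite ?natr_int ?ler_nat//.
      by rewrite -(@pmulr_rge0 _ k%:R) ?ltr0n// (le_trans (ltW r_gt0)).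
    by move=> ku -> w0; split; rewrite ?natr_int ?ler_nat.
  split => [i||i]; rewrite ?mxE; [by have [] := wS i | | by have [] := wS i].
  rewrite (bigD1 j)//= !mxE.
  have := wA j; rewrite /A eqxx => -[k [_ _ -> rk]].
  apply: (le_trans rk); rewrite lerDl; apply: sumr_ge0 => i _; rewrite !mxE.
  by have [_ ? _ ?] := wS i; exact: mulr_ge0.
move=> i; have [_ zP wP] := zwP i; rewrite /A.
by case: eqP => // ij; apply: zP; rewrite ij.
Qed.

End hulls.

Theorem theorem5 (R : realType) (n : nat) (r : R) (u : 'I_n -> nat)
  (n_ge1 : (1 <= n)%N) (r_gt0 : 0 < r) (u_gt0 : forall i : 'I_n, (0 < u i)%N) :
  convex_hull (covering_set r u) =
  [set p : 'rV[R]_n * 'rV[R]_n |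
     closure (convex_hull (axis_union r u)) p /\ x_bounded u p].
Proof.
apply/seteqP; split=> [|p [Cp pu]]; last exact: closure_bounded_sub_hull.
apply: convex_hull_sub => [|p pS]; last first.
  by split; [exact: covering_set_sub_closure | case: pS].
have /convex_setP cC := convex_closure (@convex_convex_hull R _ (axis_union r u)).
apply/convex_setP => x y t t0 t1 [Cx xu] [Cy yu]; split; first exact: cC.
move=> i; rewrite !mxE -[leRHS]mul1r -[X in _ <= X * _](subrKC t 1) [leRHS]mulrDl.
by rewrite lerD// ler_wpM2l// subr_ge0.
Qed.
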